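(* For all integers $k\ge 2$, $n\ge 0$ and all $0\le\lambda\le 1$, $$G_{k,n}(\lambda)=\sum_{m=0}^{n}\frac{n!}{n^m(n-m)!}\binom{m+k-2}{k-2}\lambda^m .$$
   Context: $\Delta^{k-1}=\{p\in\mathbb{R}^k: p_i\ge 0,\ \sum_{i=1}^k p_i=1\}$. For integers $k\ge 1$, $n\ge 1$, $p\in\Delta^{k-1}$, $\lambda\in[0,1]$, $$G_{k,n}(\lambda,p):=\sum_{X_1,\dots,X_k}\binom{n}{X_1,\dots,X_k}\prod_{i=1}^k\left[\lambda X_i/n+(1-\lambda)p_i\right]^{X_i},$$ where the sum is over non-negative integers $X_1,\dots,X_k$ with $X_1+\dots+X_k=n$. This value does not depend on $p\in\Delta^{k-1}$; the common value is denoted $G_{k,n}(\lambda)$. For $n=0$, $G_{k,0}(\lambda):=1$. Convention: $0^0=1$. *)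

(* Defs.v *)
From mathcomp Require Import all_boot all_order all_algebra.
From mathcomp Require Import reals.

Set Implicit Arguments.
Unset Strict Implicit.
Unset Printing Implicit Defensive.

Import Order.TTheory GRing.Theory Num.Theory.
Local Open Scope ring_scope.

Definition in_simplex (R : realType) (k : nat) (p : 'rV[R]_k) : Prop :=
  (forall i, 0 <= p 0 i) /\ \sum_(i < k) p 0 i = 1.

(* The sum is over the [X] with total [n]; then every [X i] is at most [n],
   so ranging over functions into ['I_n.+1] loses nothing. *)
Definition compositions (k n : nat) : {set {ffun 'I_k -> 'I_n.+1}} :=
  [set X : {ffun 'I_k -> 'I_n.+1} | (\sum_(i < k) X i)%N == n].

(* The division in [nat] is exact when the [X i] sum to [n]. *)
Definition multinomial (k n : nat) (X : 'I_k -> nat) : nat :=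
  (n`! %/ \prod_(i < k) (X i)`!)%N.

(* [x ^+ 0 = 1] for every [x], including [x = 0]. *)
Definition G (R : realType) (k n : nat) (lambda : R) (p : 'rV[R]_k) : R :=
  if n == 0%N then 1 else
  \sum_(X in compositions k n)
    (multinomial n (fun i => X i))%:R *
    \prod_(i < k) (lambda * ((X i)%:R / n%:R) + (1 - lambda) * p 0 i) ^+ X i.

(* [g] is the value G_{k,n}(lambda): the value of [G k n lambda p] common to
   all points [p] of the simplex.  The simplex is nonempty for [0 < k], so
   there is at most one such [g]. *)
Definition is_common_value (R : realType) (k n : nat) (lambda g : R) : Prop :=
  forall p : 'rV[R]_k, in_simplex p -> G n lambda p = g.

(* Main.v *)
Require Import Defs.
From mathcomp Require Import all_boot all_order all_algebra.
From mathcomp Require Import reals.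
From mathcomp Require Import ring.
Import Order.TTheory GRing.Theory Num.Theory.
Local Open Scope ring_scope.

(** Why the identity holds.  Write [a] for [lambda / n] and put
    A_x(q) = (q + a x)^x / x!.  Dividing by [n!], the quantity G_{k,n} is the
    coefficient of z^n in the product over i of the series
    sum_x A_x(q_i) z^x with q_i = (1 - lambda) p_i.  In terms of the tree-like
    series w = z e^(a w), Lagrange inversion gives
    sum_x A_x(q) z^x = e^(q w) / (1 - a w), so the product is
    e^(Q w) / (1 - a w)^k with Q = sum_i q_i: only Q survives, which is why
    the value does not depend on p.  Lagrange inversion once more shows that
    the coefficient of z^n is that of w^n in
    e^((Q + a n) w) / (1 - a w)^(k - 1), and here Q + a n = 1.

    The proof below is a finite version of this.  The core, the case of
    two factors, is Cauchy's form of Abel's binomial identity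
    ([abel_conv]): since (q + a x) + (r + a (n - x)) = s does not depend
    on x, expanding the second factor around s leaves d-th finite differences
    of a polynomial of degree d ([finite_difference_pow]), which are constant.
    Each further factor raises the exponent of 1 / (1 - a w) by one, which is
    the hockey-stick identity for the coefficients of these powers
    ([abel_coef_conv]). *)

(** The d-th difference operator kills powers of exponent less than d and
    sends a degree d polynomial to d! times its leading coefficient.  Peeling
    off one factor [q + a x] and absorbing [x] into the binomial coefficient
    lowers [d] and [e] together, so [q] has to vary in the induction. *)
Lemma finite_difference_pow {R : comNzRingType} (a : R) (e d : nat) (q : R) :
  (e <= d)%N ->
  \sum_(x < d.+1) (-1) ^+ (d - x) *+ 'C(d, x) * (q + a * x%:R) ^+ e
    = (a ^+ d *+ d`!) *+ (e == d).
Proof.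
elim: e d q => [|e IHe] [|d] q //.
- by move=> _; rewrite big_ord1 subnn !expr0 bin0 mulr1.
- move=> _; transitivity ((- 1 + 1 : R) ^+ d.+1); last first.
    by rewrite addNr expr0n.
  rewrite exprDn; apply: eq_bigr => x _.
  by rewrite expr0 expr1n !mulr1.
rewrite ltnS => le_ed.
under eq_bigr => x _ do rewrite exprS mulrCA mulrDl.
rewrite big_split /= -mulr_sumr IHe ?(leq_trans le_ed) //.
rewrite (ltn_eqF (leq_trans _ (_ : d < d.+1)%N)) // mulr0n mulr0 add0r.
rewrite big_ord_recl /= mulr0 mul0r add0r.
rewrite eqSS factS exprS.
transitivity (a *+ d.+1 * (a ^+ d *+ d`! *+ (e == d))); last first.
  case: (e == d); rewrite ?mulr0n ?mulr0 // !mulr1n.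
  by rewrite mulrnAl mulrnAr -mulrnA mulnC.
rewrite -(IHe d (q + a)) // mulr_sumr; apply: eq_bigr => x _.
rewrite /bump /= add1n subSS.
have -> : q + a * x.+1%:R = q + a + a * x%:R by rewrite -natr1; ring.
have /(congr1 (fun m : nat => m%:R : R)) := mul_bin_diag d.+1 x.
rewrite /= !natrM => E.
rewrite -[_ *+ 'C(d, x)]mulr_natr -[_ *+ 'C(d.+1, _)]mulr_natr.
rewrite -[a *+ _]mulr_natr.
transitivity (a * (x.+1%:R * 'C(d.+1, x.+1)%:R) *
    ((-1) ^+ (d - x) * (q + a + a * x%:R) ^+ e)); first by ring.
by rewrite -E; ring.
Qed.

Lemma sum_triangle {V : nmodType} (F : nat -> nat -> V) (n : nat) :
  \sum_(i < n.+1) \sum_(j < (n - i).+1) F i j =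
  \sum_(d < n.+1) \sum_(i < d.+1) F i (d - i)%N.
Proof.
elim: n => [|n IHn]; first by rewrite !big_ord1.
rewrite [RHS]big_ord_recr /= -IHn big_ord_recr /= subnn big_ord1.
rewrite [X in _ = _ + X]big_ord_recr /= subnn addrA; congr (_ + _).
rewrite -big_split /=; apply: eq_bigr => i _.
by rewrite subSn -1?ltnS // big_ord_recr.
Qed.

(** The coefficient of w^m in 1 / (1 - w)^j is ['C((m + j).-1, m)], also for
    [j = 0], where truncated subtraction gives 1, 0, 0, ... as it should.
    Multiplying by one more factor 1 / (1 - w) takes partial sums. *)
Lemma hockey_stick (j M : nat) :
  (\sum_(m < M.+1) 'C((m + j).-1, m) = 'C((M + j.+1).-1, M))%N.
Proof.
elim: M => [|M IHM]; first by rewrite big_ord1 !bin0.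
by rewrite big_ord_recr IHM !addnS addSn /= binS addnC.
Qed.

Section Abel.
Context {R : numFieldType}.
Implicit Types (a q r : R) (j n x : nat).

Lemma fact_neq0 n : n`!%:R != 0 :> R.
Proof. by rewrite pnatr_eq0 -lt0n fact_gt0. Qed.

Lemma bin_neq0 n m : (m <= n)%N -> 'C(n, m)%:R != 0 :> R.
Proof. by rewrite pnatr_eq0 -lt0n bin_gt0. Qed.

(** The divided power y^(n) = y^n / n!, the coefficient of w^n in e^(y w). *)
Definition dpow (y : R) n : R := y ^+ n / n`!%:R.

Definition abel_term a q x : R := dpow (q + a * x%:R) x.

(** The coefficient of w^n in e^((q + a n) w) / (1 - a w)^j; by Lagrange
    inversion, that of z^n in e^(q w) / (1 - a w)^(j + 1) for w = z e^(a w). *)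
Definition abel_coef a j q n : R :=
  \sum_(m < n.+1) a ^+ m *+ 'C((m + j).-1, m) * dpow (q + a * n%:R) (n - m).

Lemma dpowB (s y : R) n :
  dpow (s - y) n =
  \sum_(l < n.+1) (-1) ^+ l / l`!%:R * y ^+ l * dpow s (n - l).
Proof.
rewrite /dpow exprBn mulr_suml; apply: eq_bigr => l _.
have := bin_fact (leq_ord l : (l <= n)%N).
move=> /(congr1 (fun m : nat => m%:R : R)).
rewrite /= !natrM => E.
rewrite -mulr_natr -E.
by field; rewrite !fact_neq0 bin_neq0 // -ltnS.
Qed.

Lemma abel_conv a q r n :
  \sum_(x < n.+1) abel_term a q x * abel_term a r (n - x) =
  \sum_(d < n.+1) a ^+ d * dpow (q + r + a * n%:R) (n - d).
Proof.
set s := q + r + a * n%:R.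
pose F x l : R := (-1) ^+ l / (x`!%:R * l`!%:R) *
  (q + a * x%:R) ^+ (x + l) * dpow s (n - (x + l)).
transitivity (\sum_(x < n.+1) \sum_(l < (n - x).+1) F x l).
  apply: eq_bigr => x _; rewrite {2}/abel_term.
  have -> : r + a * (n - x)%:R = s - (q + a * x%:R).
    by rewrite natrB -1?ltnS // /s; ring.
  rewrite dpowB mulr_sumr; apply: eq_bigr => l _.
  rewrite /F /abel_term subnDA exprD /(dpow (_ + _)).
  by field; rewrite !fact_neq0.
rewrite sum_triangle.
apply: eq_bigr => d _.
(* On the diagonal d = x + l the exponent of q + a x is d for every x. *)
transitivity (\sum_(x < d.+1) (-1) ^+ (d - x) *+ 'C(d, x) * (q + a * x%:R) ^+ d
    * (dpow s (n - d) / d`!%:R)).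
  apply: eq_bigr => x _; have le_xd : (x <= d)%N by rewrite -ltnS.
  rewrite /F subnKC //.
  have := bin_fact le_xd => /(congr1 (fun m : nat => m%:R : R)).
  rewrite /= !natrM => E; rewrite -mulr_natr -E.
  by field; rewrite !fact_neq0 bin_neq0.
rewrite -mulr_suml finite_difference_pow // eqxx mulr1n -mulr_natr.
by field; rewrite fact_neq0.
Qed.

Lemma abel_coef0 a q n : abel_coef a 0 q n = abel_term a q n.
Proof.
rewrite /abel_coef big_ord_recl big1 /= ?addr0.
  by rewrite subn0 mul1r.
by move=> m _; rewrite addn0 bin_small // mulr0n mul0r.
Qed.

(** The terms of [abel_coef a j r] with a fixed index [m] are themselves
    [abel_term]s, for the shifted parameter [r + a m]; so the case [j = 0],
    that is [abel_conv], applies to each [m] separately, always with the same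
    total [q + r + a n]. *)
Lemma abel_coef_conv a j q r n :
  \sum_(x < n.+1) abel_term a q x * abel_coef a j r (n - x) =
  abel_coef a j.+1 (q + r) n.
Proof.
pose c m : R := a ^+ m *+ 'C((m + j).-1, m).
transitivity (\sum_(m < n.+1) c m * \sum_(x < (n - m).+1)
   abel_term a q x * abel_term a (r + a * m%:R) (n - m - x)).
  pose F x m := c m *
    (abel_term a q x * abel_term a (r + a * m%:R) (n - m - x)).
  transitivity (\sum_(x < n.+1) \sum_(m < (n - x).+1) F x m).
    apply: eq_bigr => x _; rewrite mulr_sumr; apply: eq_bigr => m _.
    rewrite /F mulrCA /abel_term -/(c m) -(subnAC n x m).
    have le_m : (m <= n - x)%N by rewrite -ltnS.
    by rewrite (natrB R le_m); congr (_ * (_ * dpow _ _)); ring.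
  under [RHS]eq_bigr => m _ do rewrite mulr_sumr.
  rewrite sum_triangle (sum_triangle (fun m x => F x m)).
  apply: eq_bigr => d _; rewrite (reindex_inj rev_ord_inj) /=.
  by apply: eq_bigr => i _; rewrite subSS subKn // -ltnS.
pose F m l := c m * a ^+ l * dpow (q + r + a * n%:R) (n - (m + l)).
transitivity (\sum_(m < n.+1) \sum_(l < (n - m).+1) F m l).
  apply: eq_bigr => m _; rewrite abel_conv mulr_sumr; apply: eq_bigr => l _.
  rewrite mulrA /F subnDA; congr (_ * dpow _ _).
  by rewrite natrB -1?ltnS //; ring.
rewrite sum_triangle; apply: eq_bigr => M _.
rewrite -hockey_stick -sumrMnr mulr_suml.
apply: eq_bigr => m _; have le_mM : (m <= M)%N by rewrite -ltnS.
by rewrite /F subnKC // /c mulrnAl -exprD subnKC.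
Qed.

(** Truncating every series at degree [N] leaves the coefficients up to
    [N] of the product unchanged, and makes it a product of polynomials. *)
Lemma coef_prod_abel a N k (q : 'I_k.+1 -> R) n : (n <= N)%N ->
  (\prod_(i < k.+1) \poly_(x < N.+1) abel_term a (q i) x)`_n =
  abel_coef a k (\sum_(i < k.+1) q i) n.
Proof.
elim: k q n => [|k IHk] q n le_nN.
  by rewrite !big_ord1 coef_poly ltnS le_nN abel_coef0.
rewrite !(big_ord_recl k.+1) coefM -abel_coef_conv; apply: eq_bigr => x _.
rewrite coef_poly ltnS (leq_trans _ le_nN) -1?ltnS //; congr (_ * _).
by rewrite IHk // (leq_trans (leq_subr _ _)).
Qed.

End Abel.

(** Expanding the product gives one monomial for each function [X], of degree
    the sum of the [X i], so that taking a coefficient imposes the constraint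
    on the total; this turns the sum over compositions into an iterated
    convolution. *)
Lemma sum_compositions_coef {R : comNzRingType} (k n : nat)
    (f : 'I_k -> nat -> R) :
  \sum_(X in compositions k n) \prod_(i < k) f i (X i) =
  (\prod_(i < k) \poly_(x < n.+1) f i x)`_n.
Proof.
under [in RHS]eq_bigr => i _ do rewrite poly_def.
rewrite bigA_distr_bigA coef_sum big_mkcond; apply: eq_bigr => X _.
rewrite scaler_prod -expr_sum coefZ coefXn inE eq_sym.
by case: eqP; rewrite ?mulr1 ?mulr0.
Qed.

Lemma prod_fact_dvd (k : nat) (X : 'I_k -> nat) :
  (\prod_(i < k) (X i)`! %| (\sum_(i < k) X i)`!)%N.
Proof.
elim/big_rec2: _ => // i s t _ dvd_ts.
rewrite -(bin_fact (leq_addr s (X i))) addKn dvdn_mull //.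
exact: dvdn_mul.
Qed.

Lemma multinomialE {R : numFieldType} (k n : nat) (X : 'I_k -> nat) :
  (\sum_(i < k) X i)%N = n ->
  (multinomial n X)%:R = n`!%:R * \prod_(i < k) (X i)`!%:R^-1 :> R.
Proof.
by move=> <-; rewrite prodfV -natr_prod /multinomial natf_div ?prod_fact_dvd.
Qed.

Lemma G_abel_coef (R : realType) (k n : nat) (lambda : R) (p : 'rV[R]_k.+1) :
  (0 < n)%N ->
  G n lambda p =
  n`!%:R * abel_coef (lambda / n%:R) k
             ((1 - lambda) * \sum_(i < k.+1) p 0 i) n.
Proof.
move=> n_gt0; rewrite /G -[n == 0%N]negbK -lt0n n_gt0 /=.
rewrite [(1 - _) * _]mulr_sumr -(@coef_prod_abel _ _ n) //.
rewrite -sum_compositions_coef mulr_sumr.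
apply: eq_bigr => X; rewrite inE => /eqP sumX.
rewrite multinomialE // -mulrA -big_split /=; congr (_ * _).
apply: eq_bigr => i _; rewrite /abel_term /dpow mulrC; congr (_ ^+ _ / _).
by ring.
Qed.

Theorem theorem1 (R : realType) (k n : nat) (lambda : R) :
  (2 <= k)%N -> 0 <= lambda <= 1 ->
  is_common_value k n lambda
    (\sum_(m < n.+1) n`!%:R / (n%:R ^+ m * (n - m)`!%:R) *
       'C(m + k - 2, k - 2)%:R * lambda ^+ m).
Proof.
case: k => [|[|k]] // _ _ p [_ sum_p].
have [-> | n_gt0] := posnP n.
  by rewrite /G eqxx big_ord1 /= !subSS !subn0 binn !expr0 !mulr1 divr1.
have n_neq0 : n%:R != 0 :> R by rewrite pnatr_eq0 -lt0n.
rewrite G_abel_coef // sum_p mulr_sumr; apply: eq_bigr => m _.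
have -> : (1 - lambda) * 1 + lambda / n%:R * n%:R = 1 by field.
rewrite /dpow expr1n !addnS !subSS !subn0 /= -bin_sub ?leq_addr // addKn.
by rewrite -[_ *+ 'C(_, _)]mulr_natr expr_div_n invfM; ring.
Qed.
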